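(* The composite SBM score $\gamma:\mathbb{R}_{>0}^{m+s}\to\mathbb{R}$, defined by $\gamma(\mathbf{x},\mathbf{y})=\delta^*(\mathbf{x},\mathbf{y})\cdot\max\rho^*|_{\bar P}$ with $\bar P=\bar P(\mathbf{x},\mathbf{y})=\{(\bar{\mathbf{x}},\bar{\mathbf{y}})\in P\mid \bar{\mathbf{x}}\ge\mathbf{x},\ \bar{\mathbf{y}}\le\mathbf{y}\}$, is weakly monotonic: for all activities $(\mathbf{x},\mathbf{y}),(\mathbf{x}',\mathbf{y}')\in\mathbb{R}_{>0}^{m+s}$ such that $(\mathbf{x},\mathbf{y})$ is dominated by $(\mathbf{x}',\mathbf{y}')$ (i.e. $\mathbf{x}'\le\mathbf{x}$ and $\mathbf{y}'\ge\mathbf{y}$), one has $\gamma(\mathbf{x},\mathbf{y})\le\gamma(\mathbf{x}',\mathbf{y}')$.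
   Context: Vector inequalities are componentwise; $\mathbb{R}_+=[0,\infty)$, $\mathbb{R}_{>0}=(0,\infty)$. An activity with $m$ inputs and $s$ outputs ($m,s\ge1$) is a pair $(\mathbf{x},\mathbf{y})\in\mathbb{R}_{>0}^{m+s}$ with $\mathbf{x}\in\mathbb{R}_{>0}^m$, $\mathbf{y}\in\mathbb{R}_{>0}^s$. Fix a set $\mathcal{D}$ of $n\ge 1$ reference DMUs, each identified with an activity $(\mathbf{x}_j,\mathbf{y}_j)\in\mathbb{R}_{>0}^{m+s}$, $j=1,\dots,n$; $X$ is the $m\times n$ matrix with columns $\mathbf{x}_j$ and $Y$ the $s\times n$ matrix with columns $\mathbf{y}_j$. The production possibility set is $P=\{(\mathbf{x},\mathbf{y})\in\mathbb{R}_{>0}^{m+s}\mid \mathbf{x}\ge X\boldsymbol{\lambda},\ \mathbf{y}\le Y\boldsymbol{\lambda}\text{ for some }\boldsymbol{\lambda}\in\mathbb{R}_+^n\}$. SBM efficiency score: for $(\mathbf{x},\mathbf{y})\in P$, $\rho^*(\mathbf{x},\mathbf{y})$ is the minimum of $$\rho(\mathbf{x},\mathbf{y},\mathbf{s}^-,\mathbf{s}^+)=\frac{1-\frac1m\sum_{i=1}^m s_i^-/x_i}{1+\frac1s\sum_{r=1}^s s_r^+/y_r}$$ over $\boldsymbol{\lambda}\in\mathbb{R}_+^n$, $\mathbf{s}^-\in\mathbb{R}_+^m$, $\mathbf{s}^+\in\mathbb{R}_+^s$ subject to $\mathbf{x}=X\boldsymbol{\lambda}+\mathbf{s}^-$,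 $\mathbf{y}=Y\boldsymbol{\lambda}-\mathbf{s}^+$; for $(\mathbf{x},\mathbf{y})\notin P$, $\rho^*(\mathbf{x},\mathbf{y})=1$. SBM super-efficiency score: for every activity, $\delta^*(\mathbf{x},\mathbf{y})$ is the minimum of $$\delta(\mathbf{x},\mathbf{y},\mathbf{t}^-,\mathbf{t}^+)=\frac{1+\frac1m\sum_{i=1}^m t_i^-/x_i}{1-\frac1s\sum_{r=1}^s t_r^+/y_r}$$ over $\boldsymbol{\lambda}\in\mathbb{R}_+^n$, $\mathbf{t}^-\in\mathbb{R}_+^m$, $\mathbf{t}^+\in\mathbb{R}_+^s$ subject to $\mathbf{x}+\mathbf{t}^-\ge X\boldsymbol{\lambda}$, $\mathbf{0}<\mathbf{y}-\mathbf{t}^+\le Y\boldsymbol{\lambda}$. $\max\rho^*|_{\bar P}$ denotes the maximum of $\rho^*$ over $\bar P$. *)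

(* Defs.v *)
From HB Require Import structures.
From mathcomp Require Import all_boot all_order all_algebra.
From mathcomp Require Import boolp classical_sets reals.

Set Implicit Arguments.
Unset Strict Implicit.
Unset Printing Implicit Defensive.
Import Order.TTheory GRing.Theory Num.Theory.
Local Open Scope classical_set_scope.
Local Open Scope ring_scope.

(* Attained minimum and maximum, not infimum and supremum; the value is 0 when
   they are not attained. *)
Definition minima (R : realType) (A : set R) : set R := A `&` lbound A.
Definition maxima (R : realType) (A : set R) : set R := A `&` ubound A.
Definition minimum (R : realType) (A : set R) : R := xget 0 (minima A).
Definition maximum (R : realType) (A : set R) : R := xget 0 (maxima A).

Definition vle (R : realType) (k : nat) (u v : 'cV[R]_k) : Prop :=
  forall i, u i 0 <= v i 0.
Definition vlt (R : realType) (k : nat) (u v : 'cV[R]_k) : Prop :=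
  forall i, u i 0 < v i 0.

Definition activity (R : realType) (m s : nat)
    (a : 'cV[R]_m * 'cV[R]_s) : Prop :=
  vlt 0 a.1 /\ vlt 0 a.2.

(* The DMUs are indexed by 'I_n, so two of them may have the same activity. *)
Definition reference_data (R : realType) (m s n : nat)
    (X : 'M[R]_(m, n)) (Y : 'M[R]_(s, n)) : Prop :=
  forall j, activity (col j X, col j Y).

Definition dominated (R : realType) (m s : nat)
    (a a' : 'cV[R]_m * 'cV[R]_s) : Prop :=
  vle a'.1 a.1 /\ vle a.2 a'.2.

Section SBM.
Context (R : realType) (m s n : nat).
Variables (X : 'M[R]_(m, n)) (Y : 'M[R]_(s, n)).
Implicit Type a : 'cV[R]_m * 'cV[R]_s.

Definition production_set : set ('cV[R]_m * 'cV[R]_s) :=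
  [set a | activity a /\
    exists lam : 'cV[R]_n,
      [/\ vle 0 lam, vle (X *m lam) a.1 & vle a.2 (Y *m lam)]].

Definition rho a (sm : 'cV[R]_m) (sp : 'cV[R]_s) : R :=
  (1 - m%:R^-1 * \sum_(i < m) sm i 0 / a.1 i 0) /
  (1 + s%:R^-1 * \sum_(r < s) sp r 0 / a.2 r 0).

Definition rho_values a : set R :=
  [set v | exists (lam : 'cV[R]_n) (sm : 'cV[R]_m) (sp : 'cV[R]_s),
    [/\ [/\ vle 0 lam, vle 0 sm & vle 0 sp],
        a.1 = X *m lam + sm, a.2 = Y *m lam - sp & v = rho a sm sp]].

Definition rho_star a : R :=
  if `[< production_set a >] then minimum (rho_values a) else 1.

Definition delta a (tm : 'cV[R]_m) (tp : 'cV[R]_s) : R :=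
  (1 + m%:R^-1 * \sum_(i < m) tm i 0 / a.1 i 0) /
  (1 - s%:R^-1 * \sum_(r < s) tp r 0 / a.2 r 0).

Definition delta_values a : set R :=
  [set v | exists (lam : 'cV[R]_n) (tm : 'cV[R]_m) (tp : 'cV[R]_s),
    [/\ [/\ vle 0 lam, vle 0 tm & vle 0 tp],
        vle (X *m lam) (a.1 + tm),
        vlt 0 (a.2 - tp), vle (a.2 - tp) (Y *m lam) & v = delta a tm tp]].

Definition delta_star a : R := minimum (delta_values a).

Definition Pbar a : set ('cV[R]_m * 'cV[R]_s) :=
  [set b | [/\ production_set b, vle a.1 b.1 & vle b.2 a.2]].

Definition gamma a : R := delta_star a * maximum (rho_star @` Pbar a).

Definition gamma_well_defined a : Prop :=
  [/\ minima (delta_values a) !=set0,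
      forall b, Pbar a b -> minima (rho_values b) !=set0
    & maxima (rho_star @` Pbar a) !=set0].

End SBM.

(* Main.v *)
Require Import Defs.
From mathcomp Require Import all_boot all_order all_algebra.
From mathcomp Require Import boolp classical_sets reals.
From mathcomp Require Import filter topology normedtype.
From mathcomp Require Import ring lra.

Set Implicit Arguments.
Unset Strict Implicit.
Unset Printing Implicit Defensive.
Import Order.TTheory GRing.Theory Num.Theory.
Import numFieldNormedType.Exports.
Local Open Scope classical_set_scope.
Local Open Scope ring_scope.

(** For activities [a] and [b] let [score_ratio a b] be the mean over the inputs
    of [b.1 i / a.1 i], divided by the mean over the outputs of
    [b.2 r / a.2 r].  Eliminating the slacks turns both SBM programs into
    minimizations of this one quantity: [delta_star a] is the minimum of
    [score_ratio a b] over [b] in [Pbar a], and, for [b] in the production set,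
    [rho_star b] is the minimum of [score_ratio b (X l, Y l)] over the
    intensity vectors [l >= 0] such that [(X l, Y l)] dominates [b].  The ratio
    can only grow when its first argument improves or its second one worsens.

    Monotonicity.  If [a'] dominates [a], then [Pbar a] is contained in
    [Pbar a'], so the maximum of [rho_star] cannot decrease.  For [delta_star],
    every [b] in [Pbar a], witnessed by an intensity [l], is dominated by
    [envelope a l = (max (a.1, X l), min (a.2, Y l))], which lies in [Pbar a]
    again.  Hence [delta_star a] is the minimum over [l] of
    [score_ratio a (envelope a l)], and this is monotone in [a] for each fixed
    [l], since [max (x, q) / x = max (1, q / x)] decreases in [x] and
    [min (y, q) / y = min (1, q / y)] decreases in [y].  Both factors of
    [gamma] are nonnegative, so their product is monotone.

    Attainment.  [Pbar a] is neither bounded nor bounded away from zero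
    outputs.  But an intensity with large total can be scaled down, and one
    with small total scaled up, while remaining a witness for the same element
    of [Pbar a]; so the intensities in a compact [shell] suffice
    ([Pbar_shell]).  This gives the minimum defining [delta_star].  It also
    gives the maximum of [rho_star], because [rho_star] is monotone on the
    production set and because [l |-> rho_star (envelope a l)] is upper
    semicontinuous ([rho_star_usc]).  For the latter, let [mu] be optimal for
    [envelope a l0].  For [t < 1] the intensity [l + t (mu - l0)] is feasible
    for [envelope a l] as soon as [l] is close to [l0]: a constraint whose value
    does not increase along [mu - l0] is inherited from [l], and every other one
    has positive slack at [l0 + t (mu - l0)] ([near_slack], [near_feasible]).  There are finitely many constraints, so
    one neighbourhood of [l0] serves all of them. *)

(** * Extrema *)

Lemma minimaE (R : realType) (A : set R) v : minima A v -> minimum A = v.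
Proof.
move=> /[dup] Av [vA lbv].
have [mA lbA] := xgetPex 0 (ex_intro _ v Av : minima A !=set0).
rewrite /minimum.
by apply/eqP; rewrite eq_le lbA// lbv.
Qed.

Lemma maximaE (R : realType) (A : set R) v : maxima A v -> maximum A = v.
Proof.
move=> /[dup] Av [vA ubv].
have [mA ubA] := xgetPex 0 (ex_intro _ v Av : maxima A !=set0).
rewrite /maximum.
by apply/eqP; rewrite eq_le ubA// ubv.
Qed.

(** If the maximum were not attained, every point of [K] would have a
    neighbourhood on which [g] stays below some value of [g].  Compactness makes
    this uniform along the filter of superlevel sets of [g], and then a single
    value [g y] exceeds [g] on all of [K], including at [y]. *)
Lemma compact_usc_max (T : topologicalType) (R : realType) (K : set T)
    (g : T -> R) :
  compact K -> K !=set0 ->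
  (forall x c, K x -> g x < c -> \forall y \near x, K y -> g y < c) ->
  exists2 x, K x & forall y, K y -> g y <= g x.
Proof.
move=> /compact_near_coveringP/near_covering_withinP cK K0 usc.
apply: contrapT => nomax.
have larger x : K x -> exists2 y, K y & g x < g y.
  move=> Kx; apply: contrapT => no; apply: nomax; exists x => // y Ky.
  by rewrite leNgt; apply/negP => gxy; apply: no; exists y.
pose F := filter_from K (fun y => [set z | K z /\ g y <= g z]).
have FF : Filter F.
  apply: filter_from_filter => // y z Ky Kz.
  have [yz|zy] := leP (g y) (g z).
    by exists z => // w [Kw zw]; split; split=> //; exact: le_trans zw.
  by exists y => // w [Kw zw]; split; split=> //; apply: le_trans zw; exact: ltW.
have [|y Ky sub] := cK T F (fun i x => g x < g i) FF.
  move=> x Kx; have [y Ky gxy] := larger x Kx.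
  have Fy : F [set z | K z /\ g y <= g z] by exists y.
  near=> x' i => /= Kx'.
  have lt' : g x' < g y by move: Kx'; near: x'; exact: usc.
  by apply: (lt_le_trans lt'); have [] : K i /\ g y <= g i by near: i.
by have := sub y (conj Ky (lexx _)) y Ky; rewrite /= ltxx.
Unshelve. all: end_near. Qed.

(** * Componentwise order *)

Section Order.
Context (R : realType).

Lemma vle_trans k (v u w : 'cV[R]_k) : vle u v -> vle v w -> vle u w.
Proof. by move=> uv vw i; exact: le_trans (uv i) (vw i). Qed.

Lemma vlt_vle k (u v : 'cV[R]_k) : vlt u v -> vle u v.
Proof. by move=> uv i; exact: ltW. Qed.

Lemma vlt_le_trans k (v u w : 'cV[R]_k) : vlt u v -> vle v w -> vlt u w.
Proof. by move=> uv vw i; exact: lt_le_trans (uv i) (vw i). Qed.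

Lemma vle_mulmx k n (A : 'M[R]_(k, n)) (u v : 'cV[R]_n) :
  (forall i j, 0 <= A i j) -> vle u v -> vle (A *m u) (A *m v).
Proof.
by move=> A0 uv i; rewrite !mxE; apply: ler_sum => j _; exact: ler_wpM2l.
Qed.

Lemma vle_addr k (u v : 'cV[R]_k) : vle 0 v -> vle u (u + v).
Proof. by move=> v0 i; rewrite mxE lerDl; have := v0 i; rewrite mxE. Qed.

Lemma vle_subr k (u v : 'cV[R]_k) : vle 0 v -> vle (u - v) u.
Proof. by move=> v0 i; rewrite !mxE gerBl; have := v0 i; rewrite mxE. Qed.

Lemma vle_sub0 k (u v : 'cV[R]_k) : vle u v -> vle 0 (v - u).
Proof. by move=> uv i; rewrite !mxE subr_ge0. Qed.

Lemma dominated_trans m s (b a c : 'cV[R]_m * 'cV[R]_s) :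
  dominated a b -> dominated b c -> dominated a c.
Proof.
move=> [ab1 ab2] [bc1 bc2].
by split; [exact: vle_trans ab1|exact: vle_trans bc2].
Qed.

Lemma dominated_refl m s (a : 'cV[R]_m * 'cV[R]_s) : dominated a a.
Proof. by split=> i; exact: lexx. Qed.

End Order.

(** * Mean ratios *)

Section MeanRatio.
Context (R : realType).

Definition mean_ratio k (u v : 'cV[R]_k) : R :=
  k%:R^-1 * \sum_(i < k) v i 0 / u i 0.

Lemma mean_ratio_ge0 k (u v : 'cV[R]_k) :
  vlt 0 u -> vle 0 v -> 0 <= mean_ratio u v.
Proof.
move=> u0 v0; rewrite mulr_ge0 ?invr_ge0//; apply: sumr_ge0 => i _.
have := u0 i; have := v0 i; rewrite !mxE => vi ui.
by rewrite divr_ge0// ltW.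
Qed.

Lemma mean_ratio_gt0 k (u v : 'cV[R]_k) :
  (0 < k)%N -> vlt 0 u -> vlt 0 v -> 0 < mean_ratio u v.
Proof.
case: k u v => // k u v _ u0 v0; rewrite mulr_gt0 ?invr_gt0 ?ltr0n//.
have pos i : 0 < v i 0 / u i 0.
  by have := u0 i; have := v0 i; rewrite !mxE => vi ui; rewrite divr_gt0.
by rewrite big_ord_recl ltr_pwDl// sumr_ge0// => i _; exact: ltW.
Qed.

Lemma le_mean_ratio k (u u' v v' : 'cV[R]_k) :
  vlt 0 u' -> vle u' u -> vle 0 v -> vle v v' ->
  mean_ratio u v <= mean_ratio u' v'.
Proof.
move=> u'0 u'u v0 vv'; rewrite ler_wpM2l ?invr_ge0//; apply: ler_sum => i _.
have := u'0 i; have := v0 i; rewrite !mxE => vi ui.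
have ui0 := lt_le_trans ui (u'u i).
by apply: ler_pM; rewrite ?invr_ge0 ?lef_pV2 ?posrE// ltW.
Qed.

Lemma mean_ratioDl k (u t : 'cV[R]_k) : (0 < k)%N -> vlt 0 u ->
  mean_ratio u (u + t) = 1 + mean_ratio u t.
Proof.
move=> k0 u0; rewrite /mean_ratio.
under eq_bigr => i _.
  rewrite mxE mulrDl divff; last by have := u0 i; rewrite mxE => /gt_eqF ->.
  over.
by rewrite big_split/= sumr_const card_ord mulrDr mulVf// pnatr_eq0 -lt0n.
Qed.

Lemma mean_ratioN k (u t : 'cV[R]_k) : mean_ratio u (- t) = - mean_ratio u t.
Proof.
rewrite /mean_ratio -mulrN -sumrN; congr (_ * _).
by apply: eq_bigr => i _; rewrite mxE mulNr.
Qed.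

Lemma cvg_sum T (F : set_system T) {FF : Filter F} k (f : 'I_k -> T -> R) f0 :
  (forall i, f i z @[z --> F] --> f0 i) ->
  \sum_i f i z @[z --> F] --> \sum_i f0 i.
Proof. by move=> cf; apply: cvg_big => //; exact: add_continuous. Qed.

Lemma cvg_mean_ratio T (F : set_system T) {FF : Filter F} k
    (u v : T -> 'cV[R]_k) (u0 v0 : 'cV[R]_k) :
  vlt 0 u0 ->
  (forall i, u z i 0 @[z --> F] --> u0 i 0) ->
  (forall i, v z i 0 @[z --> F] --> v0 i 0) ->
  mean_ratio (u z) (v z) @[z --> F] --> mean_ratio u0 v0.
Proof.
move=> u00 cu cv; apply: cvgM; first exact: cvg_cst.
apply: cvg_sum => i; apply: cvgM => //; apply: cvgV => //.
by have := u00 i; rewrite mxE => /gt_eqF ->.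
Qed.

(** The left-hand side is [max 1 (q / x)]. *)
Lemma le_max_div (x x' q : R) : 0 < x' -> x' <= x -> 0 <= q ->
  Num.max x q / x <= Num.max x' q / x'.
Proof.
move=> x'0 x'x q0; have x0 := lt_le_trans x'0 x'x.
rewrite ler_pdivrMr// ge_max; apply/andP; split.
  by rewrite ler_peMl ?(ltW x0)// ler_pdivlMr// mul1r le_max lexx.
rewrite mulrAC ler_pdivlMr//.
by apply: ler_pM => //; [exact: ltW|rewrite le_max lexx orbT].
Qed.

(** The left-hand side is [min 1 (q / y')]. *)
Lemma le_min_div (y y' q : R) : 0 < y -> y <= y' -> 0 <= q ->
  Num.min y' q / y' <= Num.min y q / y.
Proof.
move=> y0 yy' q0; have y'0 := lt_le_trans y0 yy'.
rewrite ler_pdivlMr// le_min; apply/andP; split.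
  by rewrite ler_piMl ?(ltW y0)// ler_pdivrMr// mul1r ge_min lexx.
rewrite mulrAC ler_pdivrMr//.
apply: ler_pM => //; [|exact: ltW|by rewrite ge_min lexx orbT].
by rewrite le_min (ltW y'0).
Qed.

End MeanRatio.

Section Ratio.
Context (R : realType) (m s : nat).
Hypotheses (m_gt0 : (0 < m)%N) (s_gt0 : (0 < s)%N).
Implicit Type a b : 'cV[R]_m * 'cV[R]_s.

(** The common form of the objectives [rho] and [delta] once slacks are
    eliminated; see [rho_ratio] and [delta_ratio]. *)
Definition score_ratio a b : R := mean_ratio a.1 b.1 / mean_ratio a.2 b.2.

Lemma score_ratio_ge0 a b : activity a -> activity b -> 0 <= score_ratio a b.
Proof.
move=> [a1 a2] [b1 b2].
by rewrite divr_ge0// ?mean_ratio_ge0//; exact: vlt_vle.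
Qed.

Lemma le_score_ratio a a' b b' :
  activity a -> activity a' -> activity b -> activity b' ->
  dominated a a' -> dominated b' b -> score_ratio a b <= score_ratio a' b'.
Proof.
move=> [a1 a2] [a1' a2'] [b1 b2] [b1' b2'] [aa1 aa2] [bb1 bb2].
apply: ler_pM.
- by apply: mean_ratio_ge0 => //; exact: vlt_vle.
- by rewrite invr_ge0; apply: mean_ratio_ge0 => //; exact: vlt_vle.
- by apply: le_mean_ratio => //; exact: vlt_vle.
- rewrite lef_pV2 ?posrE ?mean_ratio_gt0//.
  by apply: le_mean_ratio => //; exact: vlt_vle.
Qed.

Lemma cvg_score_ratio T (F : set_system T) {FF : Filter F}
    (a b : T -> 'cV[R]_m * 'cV[R]_s) a0 b0 :
  activity a0 -> vlt 0 b0.2 ->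
  (forall i, (a z).1 i 0 @[z --> F] --> a0.1 i 0) ->
  (forall r, (a z).2 r 0 @[z --> F] --> a0.2 r 0) ->
  (forall i, (b z).1 i 0 @[z --> F] --> b0.1 i 0) ->
  (forall r, (b z).2 r 0 @[z --> F] --> b0.2 r 0) ->
  score_ratio (a z) (b z) @[z --> F] --> score_ratio a0 b0.
Proof.
move=> [a01 a02] b02 ca1 ca2 cb1 cb2.
apply: cvgM; first exact: cvg_mean_ratio.
apply: cvgV; last exact: cvg_mean_ratio.
by rewrite gt_eqF// mean_ratio_gt0.
Qed.

End Ratio.

(** * Intensity vectors: compactness and perturbation *)

Section Shell.
Context (R : realType).

Lemma continuous_trmx (T : topologicalType) m n :
  continuous (@trmx T m n).
Proof.
move=> M A [P MP sPA]; exists (fun i j => P j i).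
  by move=> i j; have := MP j i; rewrite mxE.
by move=> N PN; apply: sPA => i j; rewrite mxE; exact: PN.
Qed.

Lemma cvg_mulmx T (F : set_system T) {FF : Filter F} k n (A : 'M[R]_(k, n))
    (v : T -> 'cV[R]_n) (v0 : 'cV[R]_n) :
  (forall j, v z j 0 @[z --> F] --> v0 j 0) ->
  forall i, (A *m v z) i 0 @[z --> F] --> (A *m v0) i 0.
Proof.
move=> cv i; rewrite mxE; under eq_fun do rewrite mxE.
apply: cvg_sum => j.
by apply: cvgM; [exact: cvg_cst|exact: cv].
Qed.

Lemma continuous_mulmx_coord k n (A : 'M[R]_(k, n)) i :
  forall v : 'cV[R]_n, (A *m w) i 0 @[w --> v] --> (A *m v) i 0.
Proof.
move=> v; apply: (@cvg_mulmx _ (nbhs v)) => j; exact: coord_continuous.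
Qed.

Lemma closed_vle (T : topologicalType) k (f g : T -> 'cV[R]_k) :
  (forall z i, f x i 0 @[x --> z] --> f z i 0) ->
  (forall z i, g x i 0 @[x --> z] --> g z i 0) ->
  closed [set z | vle (f z) (g z)].
Proof.
move=> cf cg.
rewrite (_ : mkset _ = \bigcap_i
    (fun z => g z i 0 - f z i 0) @^-1` [set x | 0 <= x]); last first.
  apply/seteqP; split => z /=.
    by move=> fg i _ /=; rewrite subr_ge0.
  by move=> fg i; have := fg i I; rewrite /= subr_ge0.
apply: closed_bigI => i _; apply: preimage_closed; last exact: closed_ge.
by move=> z _; apply: cvgB; [exact: cg|exact: cf].
Qed.

Definition vsum n (l : 'cV[R]_n) : R := \sum_j l j 0.

Lemma le_vsum n (l : 'cV[R]_n) j : vle 0 l -> l j 0 <= vsum l.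
Proof.
move=> l0; rewrite /vsum (bigD1 j)//= lerDl; apply: sumr_ge0 => i _.
by have := l0 i; rewrite mxE.
Qed.

Lemma vsumZ n c (l : 'cV[R]_n) : vsum (c *: l) = c * vsum l.
Proof. by rewrite /vsum mulr_sumr; apply: eq_bigr => j _; rewrite mxE. Qed.

Lemma vsum_ge0 n (l : 'cV[R]_n) : vle 0 l -> 0 <= vsum l.
Proof. by move=> l0; apply: sumr_ge0 => j _; have := l0 j; rewrite mxE. Qed.

(** One parameter bounds the total on both sides because [near_thresholds] lets
    [e] be as small as desired. *)
Definition shell n (e : R) : set 'cV[R]_n :=
  [set l | vle 0 l /\ e <= vsum l <= e^-1].

(** The box containing the shell is compact by Tychonoff for row vectors, hence
    the transposition. *)
Lemma compact_shell n (e : R) : compact (@shell n e).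
Proof.
pose box := [set v : 'rV[R]_n | forall i, `[0, e^-1]%classic (v ord0 i)].
have cbox : compact (@trmx R 1 n @` box).
  apply: continuous_compact; last first.
    apply: (@rV_compact _ _ (fun=> `[0, e^-1]%classic)) => i.
    exact: segment_compact.
  by apply: continuous_subspaceT; exact: continuous_trmx.
apply: (subclosed_compact _ cbox); last first.
  move=> l [l0 /andP[_ le]]; exists l^T; last by rewrite trmxK.
  move=> i /=; rewrite in_itv/= mxE (le_trans (le_vsum i l0))// andbT.
  by have := l0 i; rewrite mxE.
have cvsum : continuous (@vsum n).
  by move=> l; apply: (@cvg_sum _ _ (nbhs l)) => j; exact: coord_continuous.
rewrite (_ : @shell n e = [set l | vle 0 l] `&`
    (@vsum n @^-1` [set x | e <= x] `&` @vsum n @^-1` [set x | x <= e^-1])).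
  apply: closedI.
    apply: closed_vle => l i; last exact: coord_continuous.
    by apply: (@cvg_cst _ _ _ (nbhs l)).
  apply: closedI.
    by apply: preimage_closed (@closed_ge R e) => l _; exact: cvsum.
  by apply: preimage_closed (@closed_le R e^-1) => l _; exact: cvsum.
apply/seteqP; split => l /=; first by move=> [l0 /andP[]].
by move=> [l0 [el le]]; split=> //; rewrite el le.
Qed.

(** A positive matrix has entries between two positive constants in each row,
    so [A *m l] is comparable, row by row, to the total of [l]. *)
Lemma near_thresholds k n (A : 'M[R]_(k, n)) (u : 'cV[R]_k) :
  (0 < n)%N -> (forall i j, 0 < A i j) -> vlt 0 u ->
  \forall e \near 0^'+, forall l, vle 0 l ->
    (vsum l <= e -> vlt (A *m l) u) /\ (e^-1 <= vsum l -> vlt u (A *m l)).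
Proof.
case: n A => // n A _ A0 u0.
(* Upper and lower bounds on row i that need no minimum or maximum. *)
pose M i := \sum_j A i j; pose c i := (\sum_j (A i j)^-1)^-1.
have M0 i : 0 < M i.
  by rewrite /M big_ord_recl ltr_pwDl// sumr_ge0// => j _; exact: ltW.
have c0 i : 0 < c i.
  rewrite invr_gt0 big_ord_recl ltr_pwDl ?invr_gt0// sumr_ge0// => j _.
  by rewrite invr_ge0 ltW.
have AM i j : A i j <= M i.
  by rewrite /M (bigD1 j)//= lerDl sumr_ge0// => j' _; exact: ltW.
have cA i j : c i <= A i j.
  rewrite -[leRHS]invrK lef_pV2 ?posrE ?invr_gt0//.
    by rewrite (bigD1 j)//= lerDl sumr_ge0// => j' _; rewrite invr_ge0 ltW.
  by rewrite -invr_gt0 c0.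
have ui i : 0 < u i 0 by have := u0 i; rewrite mxE.
near=> e.
have e0 : 0 < e by near: e; exact: nbhs_right_gt.
have eM i : e < u i 0 / M i.
  move: i; near: e; apply: filter_forall => i.
  by apply: nbhs_right_lt; rewrite divr_gt0.
have ec i : e < c i / u i 0.
  move: i; near: e; apply: filter_forall => i.
  by apply: nbhs_right_lt; rewrite divr_gt0.
move=> l l0.
have lj j : 0 <= l j 0 by have := l0 j; rewrite mxE.
split=> le i; rewrite mxE.
  apply: (@le_lt_trans _ _ (M i * vsum l)).
    by rewrite /vsum mulr_sumr ler_sum// => j _; rewrite ler_wpM2r.
  by rewrite mulrC -ltr_pdivlMr//; exact: le_lt_trans (eM i).
apply: (@lt_le_trans _ _ (c i * vsum l)); last first.
  by rewrite /vsum mulr_sumr ler_sum// => j _; rewrite ler_wpM2r.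
rewrite -ltr_pdivrMl// mulrC; apply: lt_le_trans le.
by rewrite -[ltLHS]invrK ltf_pV2 ?posrE ?invr_gt0 ?divr_gt0// invf_div.
Unshelve. all: end_near. Qed.

(** The key to feasibility under perturbation.  If [p1 <= p0], the step does not
    increase [p z].  Otherwise the limit [p0 + t * (p1 - p0)] is strictly below
    [p1 <= q0], and this slack survives near the limit. *)
Lemma near_slack T (F : set_system T) {FF : Filter F} (p q : T -> R)
    (p0 q0 p1 t : R) :
  p z @[z --> F] --> p0 -> q z @[z --> F] --> q0 ->
  0 <= t -> t < 1 -> p1 <= q0 ->
  \forall z \near F, p z <= q z -> p z + t * (p1 - p0) <= q z.
Proof.
move=> cp cq t0 t1 pq; have [p10|p01] := leP p1 p0.
  near=> z => pqz; apply: le_trans pqz.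
  by rewrite gerDl mulr_ge0_le0// subr_le0.
have cpq : q z - p z @[z --> F] --> q0 - p0 by exact: cvgB.
have slack : t * (p1 - p0) < q0 - p0.
  have lt : t * (p1 - p0) < p1 - p0 by rewrite gtr_pMl// subr_gt0.
  by apply: lt_le_trans lt _; rewrite lerD2r.
near=> z => _; rewrite -lerBrDl ltW//.
by near: z; exact: cvgr_gt slack.
Unshelve. all: end_near. Qed.

End Shell.

(** * The scores as optimal ratios *)

Section Scores.
Context (R : realType) (m s n : nat).
Variables (X : 'M[R]_(m, n)) (Y : 'M[R]_(s, n)).
Hypotheses (m_gt0 : (0 < m)%N) (s_gt0 : (0 < s)%N) (n_gt0 : (0 < n)%N).
Hypothesis XY_pos : reference_data X Y.
Implicit Types (a b : 'cV[R]_m * 'cV[R]_s) (l mu : 'cV[R]_n).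

Let X_gt0 i j : 0 < X i j.
Proof. by have [/(_ i) + _] := XY_pos j; rewrite !mxE. Qed.

Let Y_gt0 r j : 0 < Y r j.
Proof. by have [_ /(_ r)] := XY_pos j; rewrite !mxE. Qed.

Definition combo l : 'cV[R]_m * 'cV[R]_s := (X *m l, Y *m l).

Definition feasible b : set 'cV[R]_n :=
  [set l | vle 0 l /\ dominated b (combo l)].

Lemma production_setP b :
  production_set X Y b <-> activity b /\ feasible b !=set0.
Proof.
by split=> [[b0 [l [l0 Xl Yl]]]|[b0 [l [l0 [Xl Yl]]]]]; split=> //; exists l.
Qed.

(** The slacks only record the distance from [b] to the point that it is
    compared with. *)
Lemma rho_ratio b sm sp : activity b ->
  rho b sm sp = score_ratio b (b.1 - sm, b.2 + sp).
Proof.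
by move=> [b1 b2]; rewrite /score_ratio/= !mean_ratioDl// mean_ratioN.
Qed.

Lemma delta_ratio a tm tp : activity a ->
  delta a tm tp = score_ratio a (a.1 + tm, a.2 - tp).
Proof.
by move=> [a1 a2]; rewrite /score_ratio/= !mean_ratioDl// mean_ratioN.
Qed.

(** The slacks are determined by the intensity [l]. *)
Lemma rho_valuesE b : activity b ->
  rho_values X Y b = (fun l => score_ratio b (combo l)) @` feasible b.
Proof.
move=> b0; apply/seteqP; split => v /=.
  move=> [l [sm [sp [[l0 sm0 sp0] e1 e2 ->]]]].
  have eX : X *m l = b.1 - sm by rewrite e1 addrK.
  have eY : Y *m l = b.2 + sp by rewrite e2 subrK.
  exists l; last by rewrite rho_ratio// /combo eX eY.
  by split=> //; split; rewrite /= ?eX ?eY; [exact: vle_subr|exact: vle_addr].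
move=> [l [l0 [Xl Yl]] <-].
exists l, (b.1 - X *m l), (Y *m l - b.2); split.
- by split=> //; exact: vle_sub0.
- by rewrite addrC subrK.
- by rewrite opprB addrC subrK.
- by rewrite rho_ratio// opprB addrC subrK addrC subrK.
Qed.

(** Moving [a] by the slacks reaches exactly the points of [Pbar a]; the
    intensity only certifies membership in the production set. *)
Lemma delta_valuesE a : activity a ->
  delta_values X Y a = score_ratio a @` Pbar X Y a.
Proof.
move=> a0; apply/seteqP; split => v /=.
  move=> [l [tm [tp [[l0 tm0 tp0] Xl tpa Yl ->]]]].
  exists (a.1 + tm, a.2 - tp); last by rewrite delta_ratio.
  split; [|exact: vle_addr|exact: vle_subr].
  split; last by exists l.
  by split=> //; apply: vlt_le_trans (vle_addr _ tm0); case: a0.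
move=> [b [[[b1 b2] [l [l0 Xl Yl]]] ab1 ab2] <-].
exists l, (b.1 - a.1), (a.2 - b.2); split.
- by split=> //; exact: vle_sub0.
- by rewrite addrC subrK.
- by rewrite opprB addrC subrK.
- by rewrite opprB addrC subrK.
- rewrite delta_ratio// opprB addrC subrK addrC subrK.
  by case: b {b1 b2 Xl Yl ab1 ab2}.
Qed.

Lemma activity_combo l : vle 0 l -> 0 < vsum l -> activity (combo l).
Proof.
move=> l0 tl.
have [j lj] : exists j, 0 < l j 0.
  apply: contrapT => no; move: tl; rewrite ltNge => /negP; apply.
  apply: sumr_le0 => j _; rewrite leNgt; apply/negP => lj.
  by apply: no; exists j.
have pos k (A : 'M[R]_(k, n)) : (forall i j, 0 < A i j) -> vlt 0 (A *m l).
  move=> A0 i; rewrite !mxE (bigD1 j)//= ltr_pwDl ?mulr_gt0// sumr_ge0//.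
  by move=> j' _; rewrite mulr_ge0 ?(ltW (A0 _ _))//; have := l0 j'; rewrite mxE.
by split; exact: pos.
Qed.

(** Zero intensity produces nothing, while activities have positive outputs. *)
Lemma vsum_feasible b l : activity b -> feasible b l -> 0 < vsum l.
Proof.
move=> [_ b2] [l0 [_ Yl]]; rewrite lt_neqAle vsum_ge0// andbT eq_sym.
apply/negP => /eqP tl.
have l_eq0 : l = 0.
  apply/colP => j; apply/eqP; rewrite eq_le l0 andbT mxE -tl.
  exact: le_vsum.
have := vlt_le_trans b2 Yl (Ordinal s_gt0).
by rewrite l_eq0 /= mulmx0 ltxx.
Qed.

Lemma thresholds a : activity a -> exists e : R, [/\ 0 < e, e < 1 &
  forall l, vle 0 l ->
    (vsum l <= e -> vlt (X *m l) a.1 /\ vlt (Y *m l) a.2) /\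
    (e^-1 <= vsum l -> vlt a.1 (X *m l) /\ vlt a.2 (Y *m l))].
Proof.
move=> [a1 a2].
have nX := near_thresholds n_gt0 X_gt0 a1.
have nY := near_thresholds n_gt0 Y_gt0 a2.
near (0 : R)^'+ => e; exists e; split.
- by near: e; exact: nbhs_right_gt.
- by near: e; exact: nbhs_right_lt.
have tX : forall l, vle 0 l -> (vsum l <= e -> vlt (X *m l) a.1) /\
    (e^-1 <= vsum l -> vlt a.1 (X *m l)) by near: e.
have tY : forall l, vle 0 l -> (vsum l <= e -> vlt (Y *m l) a.2) /\
    (e^-1 <= vsum l -> vlt a.2 (Y *m l)) by near: e.
move=> l l0; have [Xs Xb] := tX l l0; have [Ys Yb] := tY l l0.
by split=> le; split; auto.
Unshelve. all: end_near. Qed.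

(** Inputs bound the intensities above, and outputs bound them away from [0], so
    the feasible set is a closed part of a shell. *)
Lemma compact_feasible b : activity b -> compact (feasible b).
Proof.
move=> b0; have [e [e0 e1 th]] := thresholds b0.
have -> : feasible b = shell e `&`
    ([set l | vle (X *m l) b.1] `&` [set l | vle b.2 (Y *m l)]).
  apply/seteqP; split => l.
    move=> [l0 [Xl Yl]]; have [small big] := th l l0.
    split=> //; split=> //; apply/andP; split.
      rewrite leNgt; apply/negP => /ltW/small[_ Yb].
      by have := Yb (Ordinal s_gt0); rewrite ltNge Yl.
    rewrite leNgt; apply/negP => /ltW/big[Xb _].
    by have := Xb (Ordinal m_gt0); rewrite ltNge Xl.
  by move=> [[l0 _] [Xl Yl]].
apply: compact_closedI; first exact: compact_shell.
apply: closedI; apply: closed_vle => l i.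
- exact: continuous_mulmx_coord.
- by apply: (@cvg_cst _ _ _ (nbhs l)).
- by apply: (@cvg_cst _ _ _ (nbhs l)).
- exact: continuous_mulmx_coord.
Qed.

(** Above the upper threshold, a witness can shrink until its total is [e^-1]:
    its outputs still exceed [a.2 >= b.2].  Below the lower one it can grow
    until its total is [e]: its inputs are still less than [a.1 <= b.1]. *)
Lemma Pbar_shell a : activity a -> exists2 e : R, 0 < e &
  forall b, Pbar X Y a b -> exists2 l, shell e l & feasible b l.
Proof.
move=> a0; have [e [e0 e1 th]] := thresholds a0.
exists e => // b [/production_setP[b0 [l fl]] ab1 ab2].
have tl := vsum_feasible b0 fl; have [l0 [/= Xl Yl]] := fl.
have e_le : e <= e^-1.
  by rewrite (le_trans (ltW e1))// -[leLHS]invr1 lef_pV2 ?posrE// ltW.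
have scale_ge0 c : 0 <= c -> vle 0 (c *: l).
  by move=> c0 j; have := l0 j; rewrite !mxE => lj; exact: mulr_ge0.
have [et|te] := leP e (vsum l).
  have [te|et'] := leP (vsum l) e^-1.
    by exists l => //; split=> //; rewrite et.
  pose c := e^-1 / vsum l.
  have c0 : 0 <= c by rewrite divr_ge0 ?invr_ge0 ?ltW.
  have tc : vsum (c *: l) = e^-1 by rewrite vsumZ divfK ?gt_eqF.
  have cle : vle (c *: l) l.
    move=> j; rewrite mxE ler_piMl//; first by have := l0 j; rewrite mxE.
    by rewrite ler_pdivrMr// mul1r ltW.
  exists (c *: l); first by split; [exact: scale_ge0|rewrite tc e_le lexx].
  split; first exact: scale_ge0.
  have [_ big] := th _ (scale_ge0 c c0).
  have [|_ Yc] := big; first by rewrite tc.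
  split; last exact: vle_trans ab2 (vlt_vle Yc).
  by apply: vle_trans Xl; apply: vle_mulmx => // i j; exact: ltW.
pose c := e / vsum l.
have c0 : 0 <= c by rewrite divr_ge0 ?ltW.
have tc : vsum (c *: l) = e by rewrite vsumZ divfK ?gt_eqF.
have cge : vle l (c *: l).
  move=> j; rewrite mxE ler_peMl//; first by have := l0 j; rewrite mxE.
  by rewrite ler_pdivlMr// mul1r ltW.
exists (c *: l); first by split; [exact: scale_ge0|rewrite tc e_le lexx].
split; first exact: scale_ge0.
have [small _] := th _ (scale_ge0 c c0).
have [|Xc _] := small; first by rewrite tc.
split; first exact: vle_trans (vlt_vle Xc) ab1.
by apply: vle_trans Yl _; apply: vle_mulmx => // i j; exact: ltW.
Qed.

(** The minimum of a continuous function on a compact set. *)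
Lemma rho_star_attained b : production_set X Y b ->
  exists mu, [/\ feasible b mu, minima (rho_values X Y b) (rho_star X Y b)
    & rho_star X Y b = score_ratio b (combo mu)].
Proof.
move=> /[dup] Pb /production_setP[b0 nefeas].
have [|mu fmu mumax] := @compact_usc_max _ R _
    (fun l => - score_ratio b (combo l)) (compact_feasible b0) nefeas.
  move=> l c fl lc.
  have [_ Yl] := activity_combo fl.1 (vsum_feasible b0 fl).
  have cvg_l : score_ratio b (combo l') @[l' --> l] -->
      score_ratio b (combo l).
    apply: (@cvg_score_ratio R m s s_gt0 _ (nbhs l)) => //.
    - by move=> i; apply: (@cvg_cst _ _ _ (nbhs l)).
    - by move=> i; apply: (@cvg_cst _ _ _ (nbhs l)).
    - by move=> i; exact: (@continuous_mulmx_coord R m n X i l).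
    - by move=> r; exact: (@continuous_mulmx_coord R s n Y r l).
  have : \forall l' \near l, - c < score_ratio b (combo l').
    by apply: (cvgr_gt (F := nbhs l) _ cvg_l); rewrite ltrNl.
  by apply: filterS => l' + _; rewrite ltrNl.
have min_mu : minima (rho_values X Y b) (score_ratio b (combo mu)).
  rewrite rho_valuesE//; split; first by exists mu.
  by move=> _ [l fl <-]; rewrite -lerN2; exact: mumax.
have eq_mu : rho_star X Y b = score_ratio b (combo mu).
  by rewrite /rho_star asboolT// (minimaE min_mu).
by exists mu; rewrite eq_mu.
Qed.

Lemma rho_star_le b l : production_set X Y b -> feasible b l ->
  rho_star X Y b <= score_ratio b (combo l).
Proof.
move=> Pb fl; have [_ [_ [_ lb] _]] := rho_star_attained Pb.
by apply: lb; rewrite rho_valuesE; [exists l|case: Pb].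
Qed.

Lemma rho_star_ge0 b : production_set X Y b -> 0 <= rho_star X Y b.
Proof.
move=> Pb; have [mu [fmu _ ->]] := rho_star_attained Pb.
have b0 := Pb.1; apply: score_ratio_ge0 => //.
exact: activity_combo fmu.1 (vsum_feasible b0 fmu).
Qed.

(** An optimal intensity for the better activity is feasible for the worse one,
    with a ratio that is no larger. *)
Lemma le_rho_star b b' : production_set X Y b -> production_set X Y b' ->
  dominated b b' -> rho_star X Y b <= rho_star X Y b'.
Proof.
move=> Pb Pb' bb'; have [mu [fmu _ ->]] := rho_star_attained Pb'.
have cmu := activity_combo fmu.1 (vsum_feasible Pb'.1 fmu).
apply: (@le_trans _ _ (score_ratio b (combo mu))).
  by apply: rho_star_le => //; split; [case: fmu|exact: dominated_trans fmu.2].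
apply: le_score_ratio => //; first by case: Pb.
- by case: Pb'.
- exact: dominated_refl.
Qed.

(** * The envelope of an activity *)

(** The best activity of [Pbar a] that the intensity [l] witnesses; see
    [dominated_envelope]. *)
Definition envelope a l : 'cV[R]_m * 'cV[R]_s :=
  (\col_i Num.max (a.1 i 0) ((X *m l) i 0),
   \col_r Num.min (a.2 r 0) ((Y *m l) r 0)).

Lemma feasible_envelope a l : vle 0 l -> feasible (envelope a l) l.
Proof.
by move=> l0; split=> //; split=> i; rewrite !mxE ?le_max ?ge_min lexx orbT.
Qed.

Lemma Pbar_envelope a l : activity a -> vle 0 l -> 0 < vsum l ->
  Pbar X Y a (envelope a l).
Proof.
move=> [a1 a2] l0 tl; have [_ Yl] := activity_combo l0 tl.
split; last 2 first.
- by move=> i; rewrite mxE le_max lexx.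
- by move=> i; rewrite mxE ge_min lexx.
apply/production_setP; split; last by exists l; exact: feasible_envelope.
split=> i; have := (a1, a2); rewrite !mxE.
  by rewrite lt_max => -[/(_ i)]; rewrite mxE => ->.
by rewrite lt_min => -[_ /(_ i)]; have := Yl i; rewrite !mxE => -> ->.
Qed.

Lemma shell_Pbar a (e : R) l : activity a -> 0 < e -> shell e l ->
  Pbar X Y a (envelope a l).
Proof.
move=> a0 e0 [l0 /andP[el _]]; apply: Pbar_envelope => //.
exact: lt_le_trans el.
Qed.

Lemma dominated_envelope a b l : Pbar X Y a b -> feasible b l ->
  dominated b (envelope a l).
Proof.
move=> [_ ab1 ab2] [_ [Xl Yl]]; split=> i.
  by rewrite mxE ge_max ab1 Xl.
by rewrite mxE le_min ab2 Yl.
Qed.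

Lemma cvg_envelope1 a l0 i :
  (envelope a l).1 i 0 @[l --> l0] --> (envelope a l0).1 i 0.
Proof.
rewrite mxE; under eq_fun do rewrite mxE.
apply: (@continuous_max _ _ (fun=> a.1 i 0) (fun l => (X *m l) i 0)).
  by apply: (@cvg_cst _ _ _ (nbhs l0)).
exact: continuous_mulmx_coord.
Qed.

Lemma cvg_envelope2 a l0 r :
  (envelope a l).2 r 0 @[l --> l0] --> (envelope a l0).2 r 0.
Proof.
rewrite mxE; under eq_fun do rewrite mxE.
apply: (@continuous_min _ _ (fun=> a.2 r 0) (fun l => (Y *m l) r 0)).
  by apply: (@cvg_cst _ _ _ (nbhs l0)).
exact: continuous_mulmx_coord.
Qed.

(** Each constraint on [l + t *: (mu - l0)] is an instance of [near_slack], with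
    signs reversed for nonnegativity and for outputs. *)
Lemma near_feasible a l0 mu (t : R) : feasible (envelope a l0) mu ->
  0 <= t -> t < 1 ->
  \forall l \near l0, vle 0 l ->
    feasible (envelope a l) (l + t *: (mu - l0)).
Proof.
move=> [mu0 [Xmu Ymu]] t0 t1.
have coordE k (A : 'M[R]_(k, n)) l i : (A *m (l + t *: (mu - l0))) i 0 =
    (A *m l) i 0 + t * ((A *m mu) i 0 - (A *m l0) i 0).
  by rewrite mulmxDr -scalemxAr mulmxBr !mxE.
have cvgA k (A : 'M[R]_(k, n)) i : (A *m l) i 0 @[l --> l0] --> (A *m l0) i 0.
  exact: continuous_mulmx_coord.
have n1 : \forall l \near l0, forall j : 'I_n, - (l : 'cV[R]_n) j 0 <= 0 ->
    - l j 0 + t * (- mu j 0 - - l0 j 0) <= 0.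
  apply: (@filter_forall _ _ _ (nbhs l0)) => j.
  apply: (@near_slack R _ (nbhs l0) _ (fun l => - l j 0) (fun=> 0) _ 0) => //.
  - by apply: cvgN; exact: coord_continuous.
  - by apply: (@cvg_cst _ _ _ (nbhs l0)).
  - by rewrite oppr_le0; have := mu0 j; rewrite mxE.
have n2 : \forall l \near l0, forall i, (X *m l) i 0 <= (envelope a l).1 i 0 ->
    (X *m l) i 0 + t * ((X *m mu) i 0 - (X *m l0) i 0)
      <= (envelope a l).1 i 0.
  apply: (@filter_forall _ _ _ (nbhs l0)) => i; apply: near_slack t0 t1 (Xmu i).
    exact: cvgA.
  exact: cvg_envelope1.
have n3 : \forall l \near l0, forall r,
    - (Y *m l) r 0 <= - (envelope a l).2 r 0 ->
    - (Y *m l) r 0 + t * (- (Y *m mu) r 0 - - (Y *m l0) r 0)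
      <= - (envelope a l).2 r 0.
  apply: (@filter_forall _ _ _ (nbhs l0)) => r.
  apply: (@near_slack R _ (nbhs l0) _ (fun l => - (Y *m l) r 0) _ _
    (- (envelope a l0).2 r 0)) => //.
  - by apply: cvgN; exact: cvgA.
  - by apply: cvgN; exact: cvg_envelope2.
  - by rewrite lerN2; exact: Ymu.
near=> l => lge0; have [_ [Xl Yl]] := feasible_envelope a lge0.
split.
  have n1l : forall j, - l j 0 <= 0 ->
    - l j 0 + t * (- mu j 0 - - l0 j 0) <= 0 by near: l.
  move=> j; have := n1l j; have := lge0 j; rewrite !mxE => lj /=.
  by rewrite oppr_le0 => /(_ lj) h; lra.
split=> i /=; rewrite coordE.
  have n2l : forall i, (X *m l) i 0 <= (envelope a l).1 i 0 ->
    (X *m l) i 0 + t * ((X *m mu) i 0 - (X *m l0) i 0)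
      <= (envelope a l).1 i 0 by near: l.
  exact: n2l (Xl i).
have n3l : forall r, - (Y *m l) r 0 <= - (envelope a l).2 r 0 ->
    - (Y *m l) r 0 + t * (- (Y *m mu) r 0 - - (Y *m l0) r 0)
      <= - (envelope a l).2 r 0 by near: l.
by have := n3l i; rewrite lerN2 => /(_ (Yl i)) h; lra.
Unshelve. all: end_near. Qed.

(** Stopping short of [mu] costs little in the objective, by continuity in [t],
    and makes the intensity [l + t *: (mu - l0)] available for all [l] near
    [l0]. *)
Lemma rho_star_usc a l0 c : activity a -> vle 0 l0 -> 0 < vsum l0 ->
  rho_star X Y (envelope a l0) < c ->
  \forall l \near l0, vle 0 l -> 0 < vsum l ->
    rho_star X Y (envelope a l) < c.
Proof.
move=> a0 l0_ge0 tl0; have [Pl0 _ _] := Pbar_envelope a0 l0_ge0 tl0.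
have [mu [fmu _ ->]] := rho_star_attained Pl0; move=> lt_c.
have act0 := Pl0.1.
have [_ Ymu] := activity_combo fmu.1 (vsum_feasible act0 fmu).
have [_ Yl0] := activity_combo l0_ge0 tl0.
have cvg_t : score_ratio (envelope a l0) (combo (l0 + t *: (mu - l0)))
    @[t --> (1 : R)^'-] --> score_ratio (envelope a l0) (combo mu).
  have cvg_coord j : (l0 + t *: (mu - l0)) j 0 @[t --> (1 : R)^'-] --> mu j 0.
    apply: cvg_at_left_filter.
    have -> : mu j 0 = l0 j 0 + 1 * (mu - l0) j 0 by rewrite !mxE; ring.
    under eq_fun do rewrite mxE [X in _ + X]mxE.
    apply: cvgD; first by apply: (@cvg_cst _ _ _ (nbhs (1 : R))).
    by apply: cvgMr_tmp; exact: cvg_id.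
  apply: cvg_score_ratio => //.
  - by move=> i; exact: cvg_cst.
  - by move=> i; exact: cvg_cst.
  - exact: cvg_mulmx.
  - exact: cvg_mulmx.
have [t [t0 t1 lt_t]] : exists t, [/\ 0 <= t, t < 1 &
    score_ratio (envelope a l0) (combo (l0 + t *: (mu - l0))) < c].
  near (1 : R)^'- => t; exists t; split.
  - by near: t; exact: nbhs_left_ge.
  - by near: t; exact: nbhs_left_lt.
  - by near: t; exact: cvgr_lt cvg_t _ lt_c.
have Yt : vlt 0 (Y *m (l0 + t *: (mu - l0))).
  move=> r; rewrite mulmxDr -scalemxAr mulmxBr !mxE.
  have := Yl0 r; have := Ymu r; rewrite !mxE => y0 y1.
  rewrite (_ : _ + _ = (1 - t) * \sum_j Y r j * l0 j 0 +
    t * \sum_j Y r j * mu j 0); last by ring.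
  by rewrite ltr_pwDl ?mulr_gt0 ?subr_gt0// mulr_ge0// ltW.
have cvg_l : score_ratio (envelope a l) (combo (l + t *: (mu - l0)))
    @[l --> l0] --> score_ratio (envelope a l0) (combo (l0 + t *: (mu - l0))).
  have cvg_coord j : (l + t *: (mu - l0)) j 0 @[l --> l0] -->
      (l0 + t *: (mu - l0)) j 0.
    rewrite mxE; under eq_fun do rewrite mxE.
    apply: (@cvgD _ _ _ (nbhs l0)); first exact: coord_continuous.
    by apply: (@cvg_cst _ _ _ (nbhs l0)).
  apply: (@cvg_score_ratio R m s s_gt0 _ (nbhs l0)) => //.
  - exact: cvg_envelope1.
  - exact: cvg_envelope2.
  - exact: cvg_mulmx.
  - exact: cvg_mulmx.
have n1 : \forall l \near l0,
    score_ratio (envelope a l) (combo (l + t *: (mu - l0))) < c.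
  exact: (cvgr_lt (F := nbhs l0) _ cvg_l).
have n2 := near_feasible fmu t0 t1.
apply: (@filterS2 _ (nbhs l0) _ _ _ _ _ n1 n2).
move=> l lt_l feas_l l_ge0 tl.
have [Pl _ _] := Pbar_envelope a0 l_ge0 tl.
by apply: le_lt_trans lt_l; exact: rho_star_le (feas_l l_ge0).
Unshelve. all: end_near. Qed.

Lemma shell_nonempty a e : activity a ->
  (forall b, Pbar X Y a b -> exists2 l, shell e l & feasible b l) ->
  @shell R n e !=set0.
Proof.
move=> a0 sh.
have one_ge0 : vle 0 (const_mx 1 : 'cV[R]_n) by move=> i; rewrite !mxE.
have vsum_one : 0 < vsum (const_mx 1 : 'cV[R]_n).
  rewrite /vsum; under eq_bigr do rewrite mxE.
  by rewrite sumr_const card_ord ltr0n.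
by have [l el _] := sh _ (Pbar_envelope a0 one_ge0 vsum_one); exists l.
Qed.

(** * Attainment and monotonicity *)

(** By monotonicity of [rho_star], envelopes of intensities in the shell compete
    with all of [Pbar a]. *)
Lemma maxima_rho_star a : activity a ->
  maxima (rho_star X Y @` Pbar X Y a) !=set0.
Proof.
move=> a0; have [e e0 sh] := Pbar_shell a0.
have [l c [l0 /andP[el _]] lc|l el lmax] := compact_usc_max
    (g := fun l => rho_star X Y (envelope a l)) (@compact_shell R n e)
    (shell_nonempty a0 sh).
  have := rho_star_usc a0 l0 (lt_le_trans e0 el) lc.
  apply: filterS => l' usc [l'0 /andP[el' _]].
  by apply: usc => //; exact: lt_le_trans el'.
exists (rho_star X Y (envelope a l)); split.
  by exists (envelope a l) => //; exact: (shell_Pbar a0 e0).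
move=> _ [b Pb <-]; have [l' el' fl'] := sh b Pb.
apply: le_trans (lmax l' el'); apply: le_rho_star.
- by case: Pb.
- by case: (shell_Pbar a0 e0 el').
- exact: dominated_envelope.
Qed.

Lemma minima_delta a : activity a -> minima (delta_values X Y a) !=set0.
Proof.
move=> a0; rewrite delta_valuesE//; have [e e0 sh] := Pbar_shell a0.
have [l c el lc|l el lmax] := compact_usc_max
    (g := fun l => - score_ratio a (envelope a l)) (@compact_shell R n e)
    (shell_nonempty a0 sh).
  have [[[_ env2] _] _ _] := shell_Pbar a0 e0 el.
  have cvg_l : score_ratio a (envelope a l') @[l' --> l] -->
      score_ratio a (envelope a l).
    apply: (@cvg_score_ratio R m s s_gt0 _ (nbhs l)) => //.
    - by move=> i; apply: (@cvg_cst _ _ _ (nbhs l)).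
    - by move=> i; apply: (@cvg_cst _ _ _ (nbhs l)).
    - exact: cvg_envelope1.
    - exact: cvg_envelope2.
  have : \forall l' \near l, - c < score_ratio a (envelope a l').
    by apply: (cvgr_gt (F := nbhs l) _ cvg_l); rewrite ltrNl.
  by apply: filterS => l' + _; rewrite ltrNl.
exists (score_ratio a (envelope a l)); split.
  by exists (envelope a l) => //; exact: (shell_Pbar a0 e0).
move=> _ [b Pb <-]; have [l' el' fl'] := sh b Pb.
apply: (@le_trans _ _ (score_ratio a (envelope a l'))).
  by rewrite -lerN2; exact: lmax.
apply: le_score_ratio => //.
- by case: (shell_Pbar a0 e0 el') => -[].
- by case: Pb => -[].
- exact: dominated_refl.
- exact: dominated_envelope.
Qed.

Lemma sub_Pbar a a' : dominated a a' -> Pbar X Y a `<=` Pbar X Y a'.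
Proof.
move=> [a1 a2] b [Pb ab1 ab2].
by split=> //; [exact: vle_trans ab1|exact: vle_trans a2].
Qed.

Lemma delta_star_ge0 a : activity a -> 0 <= delta_star X Y a.
Proof.
move=> a0; have [v mv] := minima_delta a0.
rewrite /delta_star (minimaE mv); move: mv; rewrite delta_valuesE//.
by move=> [[b [[b0 _] _ _] <-] _]; exact: score_ratio_ge0.
Qed.

(** Improving [a] raises the ratio through its first argument but lowers it
    through the envelope, so [le_score_ratio] does not apply; the inequality
    holds term by term. *)
Lemma le_score_envelope a a' l :
  activity a -> activity a' -> dominated a a' -> vle 0 l -> 0 < vsum l ->
  score_ratio a (envelope a l) <= score_ratio a' (envelope a' l).
Proof.
move=> a0 a0' [aa1 aa2] l0 tl.
have [Xl Yl] := activity_combo l0 tl.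
have [[[e1 e2] _] _ _] := Pbar_envelope a0 l0 tl.
have [[[e1' e2'] _] _ _] := Pbar_envelope a0' l0 tl.
have [a1 a2] := a0; have [a1' a2'] := a0'.
have le_mean k (u u' v v' : 'cV[R]_k) :
    (forall i, v i 0 / u i 0 <= v' i 0 / u' i 0) ->
    mean_ratio u v <= mean_ratio u' v'.
  by move=> h; rewrite ler_wpM2l ?invr_ge0//; apply: ler_sum => i _.
apply: ler_pM.
- by apply: mean_ratio_ge0 => //; exact: vlt_vle.
- by rewrite invr_ge0; apply: mean_ratio_ge0 => //; exact: vlt_vle.
- apply: le_mean => i; rewrite [X in X / _]mxE [X in _ <= X / _]mxE.
  apply: le_max_div => //.
    by have := a1' i; rewrite mxE.
  by have := Xl i; rewrite mxE => /ltW.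
- rewrite lef_pV2 ?posrE ?mean_ratio_gt0//.
  apply: le_mean => i; rewrite [X in X / _]mxE [X in _ <= X / _]mxE.
  apply: le_min_div => //; first by have := a2 i; rewrite mxE.
  by have := Yl i; rewrite mxE => /ltW.
Qed.

(** An optimal point for [a'] need not lie in [Pbar a], but its intensity yields
    the competitor [envelope a l]. *)
Lemma le_delta_star a a' : activity a -> activity a' -> dominated a a' ->
  delta_star X Y a <= delta_star X Y a'.
Proof.
move=> a0 a0' aa'.
have [v mv] := minima_delta a0; have [v' mv'] := minima_delta a0'.
rewrite /delta_star (minimaE mv) (minimaE mv').
move: mv mv'; rewrite !delta_valuesE// => -[_ lb] [[b' Pb' <-] _].
have [/production_setP[b0' [l fl]] _ _] := Pb'.
have tl := vsum_feasible b0' fl; have l0 := fl.1.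
have Pe := Pbar_envelope a0 l0 tl.
have [[e0' _] _ _] := Pbar_envelope a0' l0 tl.
apply: (@le_trans _ _ (score_ratio a (envelope a l))).
  by apply: lb; exists (envelope a l).
apply: le_trans (le_score_envelope a0 a0' aa' l0 tl) _.
apply: le_score_ratio => //; first exact: dominated_refl.
exact: dominated_envelope.
Qed.

Lemma gamma_is_well_defined a : activity a -> gamma_well_defined X Y a.
Proof.
move=> a0; split; [exact: minima_delta| |exact: maxima_rho_star].
move=> b [Pb _ _]; have [mu [_ mb _]] := rho_star_attained Pb.
by exists (rho_star X Y b).
Qed.

Lemma le_gamma a a' : activity a -> activity a' -> dominated a a' ->
  gamma X Y a <= gamma X Y a'.
Proof.
move=> a0 a0' aa'.
have [v mv] := maxima_rho_star a0; have [v' mv'] := maxima_rho_star a0'.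
rewrite /gamma (maximaE mv) (maximaE mv').
have [[b Pb eb] _] := mv; have [_ ub'] := mv'.
apply: ler_pM.
- exact: delta_star_ge0.
- by rewrite -eb; apply: rho_star_ge0; case: Pb.
- exact: le_delta_star.
- by apply: ub'; rewrite -eb; exists b => //; exact: (sub_Pbar aa').
Qed.

End Scores.

Theorem proposition5p3 (R : realType) (m s n : nat)
    (X : 'M[R]_(m, n)) (Y : 'M[R]_(s, n))
    (m_ge1 : (1 <= m)%N) (s_ge1 : (1 <= s)%N) (n_ge1 : (1 <= n)%N)
    (XY_pos : reference_data X Y) :
  (forall a : 'cV[R]_m * 'cV[R]_s, activity a -> gamma_well_defined X Y a) /\
  (forall a a' : 'cV[R]_m * 'cV[R]_s,
     activity a -> activity a' -> dominated a a' ->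
     gamma X Y a <= gamma X Y a').
Proof.
split=> [a|a a']; first exact: gamma_is_well_defined.
exact: le_gamma.
Qed.
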